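(* Let $A\in\mathbb{C}^{p\times p}$ be a singular matrix and let $k$ be a positive integer. Suppose that the matrix system $$AXA=A\quad\wedge\quad A^{k}X=XA^{k}$$ (in the unknown $X\in\mathbb{C}^{p\times p}$) is consistent, and let $\bar{A}$ be a $k$-commutative $\{1\}$-inverse of $A$. Then the general solution of the system is given by the formula $$X=f(Y)=\bar{A}A\bar{A}+Y-(I-\bar{A}A)YA^{k}\bar{A}^{k}-\bar{A}^{k}A^{k}Y(I-A\bar{A})-\bar{A}AYA\bar{A},$$ where $Y\in\mathbb{C}^{p\times p}$ is arbitrary; that is, for every $Y\in\mathbb{C}^{p\times p}$ the matrix $f(Y)$ is a solution of the system, and every solution $X$ is of the form $X=f(Y)$ for some $Y\in\mathbb{C}^{p\times p}$.
   Context: A $k$-commutative $\{1\}$-inverse of $A$ is a matrix $\bar{A}\in\mathbb{C}^{p\times p}$ satisfying $A\bar{A}A=A$ and $A^{k}\bar{A}=\bar{A}A^{k}$, i.e. a solution of the system in the statement; $\bar{A}^{k}$ denotes its $k$-th power. $I$ denotes the identity matrix of order $p$. A system is consistent if it has at least one solution. A formula $X=\phi(Y)$ represents the general solution of a system if $\phi(Y)$ is a solution for every $Y$, and every solution $X$ equals $\phi(Y)$ for some $Y$. *)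

(* Defs.v *)
From HB Require Import structures.
From mathcomp Require Import all_boot all_order all_algebra.
From mathcomp Require Import reals.
From mathcomp Require Import complex.

Set Implicit Arguments.
Unset Strict Implicit.
Unset Printing Implicit Defensive.

Import Order.TTheory GRing.Theory Num.Theory.
Local Open Scope ring_scope.

(* The field of complex numbers is R[i] for an arbitrary R : realType. *)
Definition is_solution (R : realType) (p : nat) (A : 'M[R[i]]_p) (k : nat)
    (X : 'M[R[i]]_p) : Prop :=
  A *m X *m A = A /\ A ^+ k *m X = X *m A ^+ k.

Definition k_commutative_inverse (R : realType) (p : nat) (A : 'M[R[i]]_p)
    (k : nat) (Abar : 'M[R[i]]_p) : Prop :=
  is_solution A k Abar.

Definition consistent (T : Type) (S : T -> Prop) : Prop := exists X, S X.

Definition general_solution (T U : Type) (S : T -> Prop) (phi : U -> T) : Prop :=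
  (forall Y, S (phi Y)) /\ (forall X, S X -> exists Y, X = phi Y).

(* Main.v *)
(* A k-commutative {1}-inverse b of a satisfies
     a^k b a = a b a^k = b a a^k = a^k a b = a^k,   a^k b^k a^k = a^k.
   With these, expanding the formula shows that f(Y) is a solution.  Conversely,
   f(X) = X for every solution X: since X commutes with a^k, the factors
   (1 - b a) and (1 - a b) meet a^k and vanish, and b a X a b = b a b. *)
Require Import Defs.
From HB Require Import structures.
From mathcomp Require Import all_boot all_order all_algebra.
From mathcomp Require Import reals.
From mathcomp Require Import complex.

Set Implicit Arguments.
Unset Strict Implicit.
Unset Printing Implicit Defensive.

Import Order.TTheory GRing.Theory Num.Theory.
Local Open Scope ring_scope.

Section KCommutativeInverse.

Variables (T : pzRingType) (a b : T) (k : nat).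
Hypotheses (k_gt0 : (0 < k)%N) (abaE : a * b * a = a).
Hypothesis comm_akb : a ^+ k * b = b * a ^+ k.

(** Since [k] is positive, a factor [a] splits off the right end of [a ^+ k] and absorbs [b * a]. *)
Lemma exp_mul_inner_inv : a ^+ k * b * a = a ^+ k.
Proof. by rewrite -(prednK k_gt0) exprSr -!mulrA [a * (b * a)]mulrA abaE. Qed.

Lemma inner_inv_mul_exp : a * b * a ^+ k = a ^+ k.
Proof. by rewrite -(prednK k_gt0) exprS mulrA abaE. Qed.

(** Here [b] is on the wrong side for [abaE]; commutation with [a ^+ k] brings it between two powers
    of [a]. *)
Lemma inner_inv_mulV_exp : b * a * a ^+ k = a ^+ k.
Proof. by rewrite -mulrA -exprS exprSr mulrA -comm_akb exp_mul_inner_inv. Qed.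

Lemma exp_mulV_inner_inv : a ^+ k * a * b = a ^+ k.
Proof. by rewrite -exprSr exprS -mulrA comm_akb mulrA inner_inv_mul_exp. Qed.

Lemma comm_exp_expV j : a ^+ k * b ^+ j = b ^+ j * a ^+ k.
Proof. exact: (commrX j comm_akb). Qed.

(** Induction on [j]: moving [b ^+ j] to the left of [a ^+ k] exposes the innermost
    [a ^+ k * b * a], which collapses to [a ^+ k]; then [b ^+ j] moves back. *)
Lemma exp_expV_exp j : a ^+ k * b ^+ j * a ^+ j = a ^+ k.
Proof.
elim: j => [|j IHj]; first by rewrite !expr0 !mulr1.
rewrite exprSr exprS !mulrA comm_exp_expV -[b ^+ j * _ * b]mulrA.
by rewrite -[b ^+ j * _ * a]mulrA exp_mul_inner_inv -comm_exp_expV.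
Qed.

Definition solution_formula (y : T) : T :=
  b * a * b + y - (1 - b * a) * y * a ^+ k * b ^+ k
  - b ^+ k * a ^+ k * y * (1 - a * b) - b * a * y * a * b.

Lemma solution_formula_inner_inv y : a * solution_formula y * a = a.
Proof.
rewrite /solution_formula; set u := 1 - b * a; set v := 1 - a * b.
have au0 : a * u = 0 by rewrite mulrBr mulr1 mulrA abaE subrr.
have va0 : v * a = 0 by rewrite mulrBl mul1r abaE subrr.
rewrite !(mulrBr a) (mulrDr a) !(mulrBl a) (mulrDl _ _ a) !mulrA au0.
rewrite -(mulrA _ v a) va0 !mul0r mulr0 !subr0 !abaE.
(* The last correction term has become [a * y * a] and cancels the contribution of the summand
   [y]. *)
by rewrite -!mulrA (mulrA a b a) abaE addrK.
Qed.

(** The first correction dies because [a ^+ k * u = 0]; the other two reduce to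
    [a ^+ k * y * (1 - a * b)] and [a ^+ k * y * a * b], whose sum cancels [a ^+ k * y]. *)
Lemma exp_mul_solution_formula y : a ^+ k * solution_formula y = a ^+ k * b.
Proof.
rewrite /solution_formula; set u := 1 - b * a.
have aku0 : a ^+ k * u = 0.
  by rewrite mulrBr mulr1 mulrA exp_mul_inner_inv subrr.
rewrite !(mulrBr (a ^+ k)) (mulrDr (a ^+ k)) !mulrA aku0 !mul0r subr0.
rewrite exp_expV_exp exp_mul_inner_inv mulrBr mulr1 !mulrA.
by rewrite opprB addrA addrAC !addrK.
Qed.

(** Mirror image of the previous computation: now the second correction dies. *)
Lemma solution_formula_mul_exp y : solution_formula y * a ^+ k = b * a ^+ k.
Proof.
rewrite /solution_formula; set v := 1 - a * b.
have vak0 : v * a ^+ k = 0 by rewrite mulrBl mul1r inner_inv_mul_exp subrr.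
rewrite !(mulrBl (a ^+ k)) (mulrDl _ _ (a ^+ k)) -(mulrA _ v) vak0 mulr0 subr0.
rewrite -!mulrA (mulrA _ (b ^+ k)) exp_expV_exp.
rewrite !(mulrA a b) inner_inv_mul_exp.
by rewrite mulrBl mul1r !mulrA opprB addrA addrAC !addrK.
Qed.

Lemma solution_formula_comm y :
  a ^+ k * solution_formula y = solution_formula y * a ^+ k.
Proof.
by rewrite exp_mul_solution_formula solution_formula_mul_exp comm_akb.
Qed.

Lemma solution_formula_fixed x :
  a * x * a = a -> a ^+ k * x = x * a ^+ k -> solution_formula x = x.
Proof.
move=> axaE comm_akx; rewrite /solution_formula.
have -> : (1 - b * a) * x * a ^+ k * b ^+ k = 0.
  rewrite -(mulrA _ x) -comm_akx !mulrA.
  by rewrite mulrBl mul1r inner_inv_mulV_exp subrr !mul0r.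
have -> : b ^+ k * a ^+ k * x * (1 - a * b) = 0.
  rewrite -(mulrA (b ^+ k)) comm_akx -!mulrA.
  by rewrite mulrBr mulr1 (mulrA _ a) exp_mulV_inner_inv subrr !mulr0.
by rewrite !subr0 -!(mulrA b) axaE addrAC subrr add0r.
Qed.

End KCommutativeInverse.

Theorem theorem2p5 (R : realType) (p : nat) (A : 'M[R[i]]_p) (k : nat)
    (A_singular : A \notin unitmx) (k_gt0 : (0 < k)%N)
    (sys_consistent : consistent (is_solution A k))
    (Abar : 'M[R[i]]_p) (Abar_inv : k_commutative_inverse A k Abar) :
  general_solution (is_solution A k)
    (fun Y : 'M[R[i]]_p =>
       Abar *m A *m Abar + Y
       - (1%:M - Abar *m A) *m Y *m A ^+ k *m Abar ^+ k
       - Abar ^+ k *m A ^+ k *m Y *m (1%:M - A *m Abar)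
       - Abar *m A *m Y *m A *m Abar).
Proof.
case: Abar_inv => abaE comm_akb; split=> [Y | X [axaE comm_akx]].
  (* For square matrices [*m] and [1%:M] are convertible to the ring product and unit, so the ring
     lemmas apply as they stand. *)
  split; first exact: (solution_formula_inner_inv k abaE Y).
  exact: (solution_formula_comm k_gt0 abaE comm_akb Y).
exists X; symmetry.
exact: (solution_formula_fixed k_gt0 abaE comm_akb axaE comm_akx).
Qed.
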